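(* Assume that $f_1$ is convex and that $f_2,f_3,h$ are convex and Lipschitz continuous, with $L_{\mathrm{obj}}>0$ the Lipschitz constant with respect to the $r$-norm of $(x,y)\mapsto f_2(x)+f_3(y)$ and $L_{\mathrm{con}}>0$ the Lipschitz constant with respect to the $r$-norm of $h$. Assume that $\mathbb{E}_{\mathbb{P}}[e^{\|\xi\|_r^a}]<\infty$ for some $a>1$. Let $\beta\in(0,1)$ be the desired level of confidence. Let $$J(g):=\mathbb{E}_{\mathbb{P}}\big[f_1(\widehat U_{\mathrm f}g)+f_2(Y_{\mathrm f}g)+f_3(Y_{\mathrm p}g-\hat y_{\mathrm{ini}})\big].$$ Consider, with $\epsilon=\epsilon(\beta,N)$ given by $$\epsilon(\beta,N)=\begin{cases}\left(\dfrac{\log(c_1\beta^{-1})}{c_2N}\right)^{1/\kappa}&\text{if }N\ge\dfrac{\log(c_1\beta^{-1})}{c_2},\\[2mm]\left(\dfrac{\log(c_1\beta^{-1})}{c_2N}\right)^{1/a}&\text{if }N<\dfrac{\log(c_1\beta^{-1})}{c_2},\end{cases}$$ (the constants $c_1,c_2$ being those of the measure concentration inequality given in the context), the optimization problem $$\text{(T)}\qquad\begin{aligned}\min_{g,\tau,s_i}\ & f_1(\widehat U_{\mathrm f}g)+\frac1N\sum_{i=1}^N\Big(f_2(\widehat Y_{\mathrm f}^{(i)}g)+f_3(\widehat Y_{\mathrm p}^{(i)}g-\hat y_{\mathrm{ini}})\Big)+L_{\mathrm{obj}}\,\epsilon\,\|g\|_{r,\ast}\\ \text{s.t.}\quad&\widehat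 U_{\mathrm p}g=\hat u_{\mathrm{ini}},\quad \widehat U_{\mathrm f}g\in\mathcal{U},\\ &-\tau\alpha+L_{\mathrm{con}}\,\epsilon\,\|g\|_{r,\ast}+\frac1N\sum_{i=1}^N s_i\le 0,\\ &\tau+h(\widehat Y_{\mathrm f}^{(i)}g)\le s_i,\quad s_i\ge0\quad\forall i\le N,\end{aligned}$$ over $g\in\mathbb{R}^\kappa$, $\tau,s_1,\dots,s_N\in\mathbb{R}$. Let $\widehat J(g)$ denote the value of the objective function of (T) at $g$ and let $\hat g^\star$ denote (the $g$-component of) an optimizer of (T). Then $$\mathbb{P}^N\big\{J(\hat g^\star)\le\widehat J(\hat g^\star)\big\}\ge1-\beta\qquad\text{and}\qquad \mathbb{P}^N\big\{\mathrm{CVaR}^{\mathbb{P}}_{1-\alpha}(h(Y_{\mathrm f}\hat g^\star))\le0\big\}\ge1-\beta.$$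
   Context: Let $m,p,T_{\mathrm{ini}},T_{\mathrm f},T,N$ be positive integers with $\kappa:=\lfloor T/(T_{\mathrm{ini}}+T_{\mathrm f})\rfloor\ge1$. Input data: for a recorded input sequence $\hat u_{[1,T]}=(\hat u_1,\dots,\hat u_T)$, $\hat u_j\in\mathbb{R}^m$, and $L=T_{\mathrm{ini}}+T_{\mathrm f}$, let $\begin{pmatrix}\widehat U_{\mathrm p}\\ \widehat U_{\mathrm f}\end{pmatrix}$, with $\widehat U_{\mathrm p}\in\mathbb{R}^{mT_{\mathrm{ini}}\times\kappa}$, $\widehat U_{\mathrm f}\in\mathbb{R}^{mT_{\mathrm f}\times\kappa}$, be the Page matrix whose $j$-th column ($j=1,\dots,\kappa$) is the stacked vector $(\hat u_{(j-1)L+1}^\top,\dots,\hat u_{jL}^\top)^\top$. The vectors $\hat u_{\mathrm{ini}}\in\mathbb{R}^{mT_{\mathrm{ini}}}$, $\hat y_{\mathrm{ini}}\in\mathbb{R}^{pT_{\mathrm{ini}}}$ are fixed, and $\mathcal{U}\subseteq\mathbb{R}^{mT_{\mathrm f}}$ is a given constraint set. Output data: the output data matrix $\begin{pmatrix}Y_{\mathrm p}\\ Y_{\mathrm f}\end{pmatrix}$, $Y_{\mathrm p}\in\mathbb{R}^{pT_{\mathrm{ini}}\times\kappa}$, $Y_{\mathrm f}\in\mathbb{R}^{pT_{\mathrm f}\times\kappa}$, is random; $\xi\in\mathbb{R}^{p(T_{\mathrm{ini}}+T_{\mathrm f})\kappa}$ is the vector obtained by stacking its rows, $\Xi$ is the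 support set of $\xi$, and $\mathbb{P}$ is the distribution of $\xi$. The samples $\hat\xi^{(1)},\dots,\hat\xi^{(N)}$ are i.i.d. with distribution $\mathbb{P}$, so that the collection is governed by the $N$-fold product distribution $\mathbb{P}^N$; $\widehat Y_{\mathrm p}^{(i)},\widehat Y_{\mathrm f}^{(i)}$ are the output data matrices corresponding to $\hat\xi^{(i)}$, and $\widehat{\mathbb{P}}_N=\frac1N\sum_{i=1}^N\delta_{\hat\xi^{(i)}}$ is the empirical distribution. In $J(\hat g^\star)$ and $\mathrm{CVaR}^{\mathbb{P}}_{1-\alpha}(h(Y_{\mathrm f}\hat g^\star))$ the sample-dependent vector $\hat g^\star$ is held fixed and the expectation is only over $Y_{\mathrm p},Y_{\mathrm f}$ determined by $\xi\sim\mathbb{P}$; the outer probability $\mathbb{P}^N$ is over the samples. Functions: $f_1:\mathbb{R}^{mT_{\mathrm f}}\to\mathbb{R}_{\ge0}$, $f_2:\mathbb{R}^{pT_{\mathrm f}}\to\mathbb{R}_{\ge0}$, $f_3:\mathbb{R}^{pT_{\mathrm{ini}}}\to\mathbb{R}_{\ge0}$, $h:\mathbb{R}^{pT_{\mathrm f}}\to\mathbb{R}$; $\alpha\in(0,1)$ is given. Norms: $r\in[1,\infty]$ is fixed, $\|\cdot\|_r$ is the $r$-norm, $\|\cdot\|_{r,\ast}$ its dual norm (the $q$-norm with $\frac1r+\frac1q=1$). Wasserstein metric: on the set $\mathcal{M}(\Xi)$ of probability distributions $\mathbb{Q}$ supported on $\Xi$ with $\mathbb{E}_{\mathbb{Q}}[\|\xi\|_r]<\infty$,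 $\mathrm{d}_{\mathrm W}(\mathbb{Q}_1,\mathbb{Q}_2)=\inf_\Pi\int_{\Xi^2}\|\xi_1-\xi_2\|_r\,\Pi(\mathrm d\xi_1,\mathrm d\xi_2)$ over joint distributions $\Pi$ with marginals $\mathbb{Q}_1,\mathbb{Q}_2$. Conditional value at risk: $\mathrm{CVaR}^{\mathbb{Q}}_{1-\alpha}(Z)=\inf_{\tau\in\mathbb{R}}\{\tau+\frac1\alpha\mathbb{E}_{\mathbb{Q}}[(Z-\tau)_+]\}$, with $(b)_+=\max\{b,0\}$. Measure concentration constants: $c_1,c_2>0$ are constants (depending on $a$, $\kappa$ and $\mathbb{E}_{\mathbb{P}}[e^{\|\xi\|_r^a}]$) for which the following measure concentration inequality, taken from the literature, holds for all $N\ge1$ and $\epsilon>0$: $$\mathbb{P}^N\{\mathrm{d}_{\mathrm W}(\mathbb{P},\widehat{\mathbb{P}}_N)\ge\epsilon\}\le\begin{cases}c_1\exp(-c_2N\epsilon^{\kappa})&\text{if }\epsilon\le1,\\ c_1\exp(-c_2N\epsilon^{a})&\text{if }\epsilon>1.\end{cases}$$ The formula for $\epsilon(\beta,N)$ presumes $c_1\ge\beta$. *)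

(* Defs.v *)
From HB Require Import structures.
From mathcomp Require Import all_boot all_order all_algebra.
From mathcomp Require Import all_classical all_reals all_analysis.
Import Order.TTheory GRing.Theory Num.Theory.
Import numFieldNormedType.Exports.

Set Implicit Arguments.
Unset Strict Implicit.
Unset Printing Implicit Defensive.

Local Open Scope classical_set_scope.
Local Open Scope ring_scope.

(* R^d with its Borel sigma-algebra. *)
Notation borel_vec R d := (g_sigma_algebraType (@open 'rV[R]_d)).

(* The r-norm, r in [1, +oo], of the family of all entries of a matrix; it is
   only applied to row and column vectors.  Values r < 1 are junk. *)
Definition rnorm (R : realType) (r : \bar R) (k l : nat) (x : 'M[R]_(k, l)) : R :=
  match r with
  | q%:E => (\sum_i \sum_j `|x i j| `^ q) `^ q^-1
  | _ => \big[Num.max/0]_i \big[Num.max/0]_j `|x i j|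
  end.

Definition dual_rnorm (R : realType) (r : \bar R) (k l : nat) (x : 'M[R]_(k, l)) : R :=
  rnorm (hoelder_conjugate r) x.

Definition rlipschitz (R : realType) (r : \bar R) (n : nat) (L : R)
    (f : 'cV[R]_n -> R) : Prop :=
  forall x y, `|f x - f y| <= L * rnorm r (x - y).

Definition convex_fun (R : realType) (n : nat) (f : 'cV[R]_n -> R) : Prop :=
  convex_function [set: convex_lmodType 'cV[R]_n] f.

Section Page.
Variables (R : realType) (m T L : nat) (u : 'I_T -> 'cV[R]_m).

Lemma page_subproof (j : 'I_(T %/ L)) (t : 'I_L) : (j * L + t < T)%N.
Proof.
rewrite (leq_trans _ (leq_divM T L))//.
by rewrite (@leq_trans (j.+1 * L))// ?leq_mul2r ?ltn_ord ?orbT// mulSn addnC ltn_add2r.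
Qed.

(* Column j is (u_(jL)^T, ..., u_(jL+L-1)^T)^T, indices starting at 0: mxvec
   concatenates the rows of its argument. *)
Definition page_mx : 'M[R]_(L * m, T %/ L) :=
  \matrix_(i, j)
    mxvec (\matrix_(t < L, k < m) u (Ordinal (page_subproof j t)) k 0) 0 i.
End Page.

Definition page_cols (T Tini Tf : nat) : nat := (T %/ (Tini + Tf))%N.

Section InputData.
Variables (R : realType) (m Tini Tf T : nat) (u : 'I_T -> 'cV[R]_m).

Let page : 'M[R]_(Tini * m + Tf * m, page_cols T Tini Tf) :=
  castmx (mulnDl Tini Tf m, erefl) (page_mx (Tini + Tf) u).

Definition Up : 'M[R]_(Tini * m, page_cols T Tini Tf) := usubmx page.
Definition Uf : 'M[R]_(Tf * m, page_cols T Tini Tf) := dsubmx page.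
End InputData.

(* xi = mxvec (col_mx Yp Yf) stacks the rows of the output data matrix. *)
Definition xi_dim (p Tini Tf T : nat) : nat :=
  ((Tini * p + Tf * p) * page_cols T Tini Tf)%N.

Section OutputData.
Variables (R : realType) (p Tini Tf T : nat).
Implicit Type xi : 'rV[R]_(xi_dim p Tini Tf T).

Definition Yp xi : 'M[R]_(Tini * p, page_cols T Tini Tf) := usubmx (vec_mx xi).
Definition Yf xi : 'M[R]_(Tf * p, page_cols T Tini Tf) := dsubmx (vec_mx xi).
End OutputData.

Section ProductPower.
Context d (X : measurableType d) (R : realType).

Definition tcons n (z : X * n.-tuple X) : n.+1.-tuple X :=
  [tuple of z.1 :: z.2].

Lemma measurable_tcons n : measurable_fun [set: X * n.-tuple X] (@tcons n).
Proof. exact: measurable_cons. Qed.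
HB.instance Definition _ n := isMeasurableFun.Build _ _ _ _ _ (@measurable_tcons n).

(* The n-fold product distribution P^n. *)
Fixpoint prob_power (P : probability X R) (n : nat) : probability (n.-tuple X) R :=
  match n return probability (n.-tuple X) R with
  | 0 => \d_([tuple] : 0.-tuple X)
  | n'.+1 => distribution (P \x prob_power P n')%E (@tcons n')
  end.

Lemma prob_powerE (P : probability X R) n (A : 'I_n -> set X) :
  (forall i, measurable (A i)) ->
  prob_power P n [set s | forall i, A i (tnth s i)] = (\prod_i P (A i))%E.
Proof.
elim: n A => [A _|n IH A mA] /=.
  by rewrite big_ord0 diracE mem_set//= => -[].
rewrite big_ord_recl /distribution /pushforward /=.
have -> : @tcons n @^-1` [set s | forall i, A i (tnth s i)] =
    A ord0 `*` [set s | forall i, A (lift ord0 i) (tnth s i)].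
  apply/seteqP; split => -[x s] /=.
    by move=> As; split=> [|i]; [have := As ord0|have := As (lift ord0 i)];
      rewrite ?tnth0 ?tnthS.
  move=> [Ax As] i; have [->|[j ->]] : i = ord0 \/ exists j, i = lift ord0 j.
  - by case: (unliftP ord0 i) => [j ->|->]; [right; exists j|left].
  - by rewrite tnth0.
  - by rewrite tnthS.
rewrite [LHS]product_measure1E//; last first.
  rewrite (_ : mkset _ = \bigcap_(i in [set: 'I_n])
      ((fun s : n.-tuple X => tnth s i) @^-1` A (lift ord0 i))).
    apply: fin_bigcap_measurable => // i _.
    by rewrite -[X in measurable X]setTI; exact: measurable_tnth.
  by apply/seteqP; split => s /= As i => [_|]; exact: As.
by congr (_ * _)%E; exact: IH.
Qed.
End ProductPower.

(* Largest probability of a measurable subset of E; it is P E if E is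
   measurable.  The dual upper value is the outer measure mu_ext P of the
   library.  They give a meaning to the probability of an event that depends
   on an arbitrary, possibly non-measurable, choice of an optimizer. *)
Definition inner_prob d (X : measurableType d) (R : realType)
    (P : probability X R) (E : set X) : \bar R :=
  ereal_sup [set P A | A in [set A | measurable A /\ A `<=` E]].

Lemma inner_probE d (X : measurableType d) (R : realType)
    (P : probability X R) (E : set X) :
  measurable E -> inner_prob P E = P E.
Proof.
move=> mE; apply/eqP; rewrite eq_le; apply/andP; split.
  apply: ge_ereal_sup => _ [A [mA AE] <-].
  by apply: le_measure => //; rewrite inE.
by apply: ereal_sup_ubound; exists E => //; split.
Qed.

(* The support: the smallest closed set of full probability. *)
Definition is_support (R : realType) (d : nat)
    (P : probability (borel_vec R d) R) (Xi : set 'rV[R]_d) : Prop :=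
  [/\ closed Xi, P Xi = 1%E &
      forall C : set 'rV[R]_d, closed C -> P C = 1%E -> Xi `<=` C].

Section Wasserstein.
Variables (R : realType) (r : \bar R) (d : nat) (Xi : set 'rV[R]_d).
Local Notation V := (borel_vec R d).

(* The joint distributions Pi are on the whole space squared, but if Q1 and Q2
   are supported on Xi then Pi is carried by Xi `*` Xi. *)
Definition is_coupling (Q1 Q2 : {measure set V -> \bar R})
    (Pi : probability (V * V)%type R) : Prop :=
  forall A : set V, measurable A ->
    Pi (fst @^-1` A) = Q1 A /\ Pi (snd @^-1` A) = Q2 A.

Definition wasserstein (Q1 Q2 : {measure set V -> \bar R}) : \bar R :=
  ereal_inf [set \int[Pi]_(z in Xi `*` Xi)
                   (rnorm r ((z.1 : 'rV[R]_d) - (z.2 : 'rV[R]_d)))%:E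
            | Pi in [set Pi | is_coupling Q1 Q2 Pi]]%E.
End Wasserstein.

Definition empirical d (X : measurableType d) (R : realType) (N : nat)
    (s : N.-tuple X) : {measure set X -> \bar R} :=
  mscale (N%:R^-1)%:nng (msum (fun i => \d_(nth point s i)) N).

(* CVaR at level 1 - alpha under Q. *)
Definition cvar d (X : measurableType d) (R : realType)
    (Q : probability X R) (alpha : R) (Z : X -> R) : \bar R :=
  ereal_inf [set (tau%:E + alpha^-1%:E * 'E_Q[fun x => Num.max (Z x - tau)%R 0%R])%E
            | tau in [set: R]].

(* Right-hand side of the measure concentration inequality for n samples. *)
Definition conc_bound (R : realType) (c1 c2 a : R) (kappa n : nat) (eps : R) : R :=
  if eps <= 1 then c1 * expR (- (c2 * n%:R * eps ^+ kappa))
  else c1 * expR (- (c2 * n%:R * eps `^ a)).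

Definition conf_radius (R : realType) (c1 c2 a : R) (kappa : nat) (beta : R) (N : nat) : R :=
  if ln (c1 * beta^-1) / c2 <= N%:R
  then (ln (c1 * beta^-1) / (c2 * N%:R)) `^ (kappa%:R^-1)
  else (ln (c1 * beta^-1) / (c2 * N%:R)) `^ a^-1.

Section Problem.
Variables (R : realType) (m p Tini Tf T : nat).
Local Notation kappa := (page_cols T Tini Tf).
Local Notation V := (borel_vec R (xi_dim p Tini Tf T)).
Variables (u : 'I_T -> 'cV[R]_m).
Variables (f1 : 'cV[R]_(Tf * m) -> R) (f2 : 'cV[R]_(Tf * p) -> R).
Variables (f3 : 'cV[R]_(Tini * p) -> R) (h : 'cV[R]_(Tf * p) -> R).
Variables (uini : 'cV[R]_(Tini * m)) (yini : 'cV[R]_(Tini * p)).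
Variables (U : set 'cV[R]_(Tf * m)).

Definition Jtrue (P : probability V R) (g : 'cV[R]_kappa) : \bar R :=
  'E_P[fun xi => f1 (Uf Tini Tf u *m g) + f2 (Yf xi *m g)
                 + f3 (Yp xi *m g - yini)].

Definition Jhat (r : \bar R) (Lobj eps : R) (N : nat) (s : N.-tuple V)
    (g : 'cV[R]_kappa) : R :=
  f1 (Uf Tini Tf u *m g)
  + N%:R^-1 * (\sum_(i < N) (f2 (Yf (tnth s i) *m g)
                              + f3 (Yp (tnth s i) *m g - yini)))
  + Lobj * eps * dual_rnorm r g.

Definition feasible (r : \bar R) (Lcon alpha eps : R) (N : nat) (s : N.-tuple V)
    (g : 'cV[R]_kappa) (tau : R) (sl : 'I_N -> R) : Prop :=
  [/\ Up Tini Tf u *m g = uini,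
      U (Uf Tini Tf u *m g),
      - tau * alpha + Lcon * eps * dual_rnorm r g
        + N%:R^-1 * (\sum_(i < N) sl i) <= 0 &
      forall i, tau + h (Yf (tnth s i) *m g) <= sl i /\ 0 <= sl i].

(* g is the g-component of an optimizer (g, tau, sl); the objective only depends
   on g. *)
Definition optimizer (r : \bar R) (Lobj Lcon alpha eps : R) (N : nat)
    (s : N.-tuple V) (g : 'cV[R]_kappa) : Prop :=
  exists tau sl, feasible r Lcon alpha eps s g tau sl /\
    forall g' tau' sl', feasible r Lcon alpha eps s g' tau' sl' ->
      Jhat r Lobj eps s g <= Jhat r Lobj eps s g'.
End Problem.

(* Main.v *)
Require Import Defs.
From mathcomp Require Import all_boot all_order all_algebra.
From mathcomp Require Import all_classical all_reals all_analysis.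
From mathcomp Require Import measurable_realfun lra.
Import Order.TTheory GRing.Theory Num.Theory.
Import numFieldNormedType.Exports.

Local Open Scope classical_set_scope.
Local Open Scope ring_scope.

(** Every coupling of P with the empirical distribution transports a nonnegative
    K-Lipschitz function F at cost K times the transport cost, so
    E_P[F] <= (1/N) sum_i F(xi_i) + K d_W(P, P_N); only this easy half of
    Kantorovich duality is needed.  By Hoelder's inequality applied to each row of
    the data matrix, the cost and the CVaR excess (h(Y_f g) + tau)_+ are Lipschitz
    in xi with constants L_obj ||g||_* and L_con ||g||_*, uniformly over g, so
    both bounds hold at g = ghat(s) on the event {d_W(P, P_N) <= eps}, which
    the choice of eps makes of (inner) probability at least 1 - beta. *)

(** * Real powers and Hoelder's inequality for finite sums *)

Lemma powR_invK (R : realType) (s t : R) :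
  0 < t -> 0 <= s -> (s `^ t^-1) `^ t = s.
Proof. by move=> t0 s0; rewrite -powRrM mulVf ?gt_eqF// powRr1. Qed.

Lemma powR_div (R : realType) (z a s : R) :
  0 <= z -> 0 <= a -> (z / a) `^ s = z `^ s / a `^ s.
Proof.
by move=> z0 a0; rewrite powRM ?invr_ge0// -[a^-1]powR_inv1// powRAC powR_inv1// powR_ge0.
Qed.

(** After dividing [x] and [y] by their norms, Young's inequality ([conjugate_powR]) bounds each
    term, and the bounds add up to 1/p + 1/q = 1. A zero norm cannot be divided by and is treated
    first. *)
Lemma hoelder_sum (R : realType) (I : finType) (x y : I -> R) (p q : R) :
  0 < p -> 0 < q -> p^-1 + q^-1 = 1 ->
  \sum_i `|x i| * `|y i| <=
    (\sum_i `|x i| `^ p) `^ p^-1 * (\sum_i `|y i| `^ q) `^ q^-1.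
Proof.
move=> p0 q0 pq.
have A0 : 0 <= \sum_i `|x i| `^ p by apply: sumr_ge0 => i _; exact: powR_ge0.
have B0 : 0 <= \sum_i `|y i| `^ q by apply: sumr_ge0 => i _; exact: powR_ge0.
have null (z : I -> R) (s : R) : \sum_i `|z i| `^ s = 0 -> forall i, `|z i| = 0.
  move=> /eqP; rewrite psumr_eq0; last by move=> i _; exact: powR_ge0.
  by move=> /allP z0 i; apply: (@powR_eq0_eq0 _ _ s); apply/eqP/z0/mem_index_enum.
have [/null x0|An0] := eqVneq (\sum_i `|x i| `^ p) 0.
  by rewrite big1 ?mulr_ge0 ?powR_ge0// => i _; rewrite x0 mul0r.
have [/null y0|Bn0] := eqVneq (\sum_i `|y i| `^ q) 0.
  by rewrite big1 ?mulr_ge0 ?powR_ge0// => i _; rewrite y0 mulr0.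
(* The norms get names [a] and [b], and the power sums become [a]^ p[and]b [^ q], the form that
   Young's inequality produces. *)
have [a a0 [aE aX]] : exists2 a, 0 < a &
    (\sum_i `|x i| `^ p) `^ p^-1 = a /\ \sum_i `|x i| `^ p = a `^ p.
  eexists; last by split; [reflexivity|rewrite powR_invK].
  by rewrite powR_gt0// lt_def An0.
have [b b0 [bE bX]] : exists2 b, 0 < b &
    (\sum_i `|y i| `^ q) `^ q^-1 = b /\ \sum_i `|y i| `^ q = b `^ q.
  eexists; last by split; [reflexivity|rewrite powR_invK].
  by rewrite powR_gt0// lt_def Bn0.
rewrite aE bE; move: An0 Bn0; rewrite aX bX => {A0 B0 aE bE} An0 Bn0.
have term i : `|x i| * `|y i| / (a * b) <=
    `|x i| `^ p / a `^ p / p + `|y i| `^ q / b `^ q / q.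
  have -> : `|x i| * `|y i| / (a * b) = (`|x i| / a) * (`|y i| / b).
    by rewrite invfM mulrACA.
  have xa0 : 0 <= `|x i| / a by exact: divr_ge0 (normr_ge0 _) (ltW a0).
  have yb0 : 0 <= `|y i| / b by exact: divr_ge0 (normr_ge0 _) (ltW b0).
  have := conjugate_powR xa0 yb0 p0 q0 pq.
  rewrite (powR_div _ _ _ p (normr_ge0 (x i)) (ltW a0)).
  by rewrite (powR_div _ _ _ q (normr_ge0 (y i)) (ltW b0)).
rewrite -[leRHS]mul1r -ler_pdivrMr ?mulr_gt0//.
rewrite mulr_suml (le_trans (ler_sum _ (fun i _ => term i)))//.
by rewrite big_split/= -!mulr_suml aX bX !divff// !mul1r pq.
Qed.

(** * Entrywise r-norms and matrix-vector products *)

Lemma rnorm_ge0 (R : realType) (r : \bar R) k l (x : 'M[R]_(k, l)) :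
  0 <= rnorm r x.
Proof.
by case: r => [q||] /=; [exact: powR_ge0|exact: bigmax_ge_id|exact: bigmax_ge_id].
Qed.

Lemma le_entry_rnormy (R : realType) k l (x : 'M[R]_(k, l)) i j :
  `|x i j| <= rnorm +oo%E x.
Proof. by rewrite /= (bigmax_sup i)// (bigmax_sup j). Qed.

Lemma rnormy_le (R : realType) k l (x : 'M[R]_(k, l)) (c : R) :
  0 <= c -> (forall i j, `|x i j| <= c) -> rnorm +oo%E x <= c.
Proof. by move=> c0 xc; apply: bigmax_le => // i _; apply: bigmax_le. Qed.

Lemma rnorm_fin_le (R : realType) (q : R) k l (x : 'M[R]_(k, l)) (c : R) :
  0 < q -> 0 <= c -> \sum_i \sum_j `|x i j| `^ q <= c `^ q ->
  rnorm q%:E x <= c.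
Proof.
move=> q0 c0 xc; rewrite /= (@le_trans _ _ ((c `^ q) `^ q^-1))//.
  apply: ge0_ler_powR; rewrite ?nnegrE ?invr_ge0 ?powR_ge0 ?(ltW q0)//.
  by apply: sumr_ge0 => i _; apply: sumr_ge0 => j _; exact: powR_ge0.
by rewrite -powRrM mulfV ?gt_eqF// powRr1.
Qed.

Lemma rnorm_finX (R : realType) (q : R) k l (x : 'M[R]_(k, l)) :
  0 < q -> rnorm q%:E x `^ q = \sum_i \sum_j `|x i j| `^ q.
Proof.
move=> q0; rewrite /= -powRrM mulVf ?gt_eqF// powRr1//.
by apply: sumr_ge0 => i _; apply: sumr_ge0 => j _; exact: powR_ge0.
Qed.

(** Distinct entries of [x] are dominated by distinct entries of [y], and the remaining entries of
    [y] only add to its norm. Reshaping, taking a block and permuting rows are all instances. *)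
Lemma le_rnorm (R : realType) (r : \bar R) k l k' l' (x : 'M[R]_(k, l))
    (y : 'M[R]_(k', l')) (f : 'I_k * 'I_l -> 'I_k' * 'I_l') :
  (1 <= r)%E -> injective f ->
  (forall i j, `|x i j| <= `|y (f (i, j)).1 (f (i, j)).2|) ->
  rnorm r x <= rnorm r y.
Proof.
move=> r1 f_inj xy; case: r r1 => [q|_|//].
  rewrite lee_fin => q1; have q0 : 0 < q by exact: lt_le_trans q1.
  apply: rnorm_fin_le => //; first exact: rnorm_ge0.
  rewrite rnorm_finX// !pair_bigA/=.
  apply: (@le_trans _ _ (\sum_p `|y (f p).1 (f p).2| `^ q)).
    apply: ler_sum => -[i j] _; apply: ge0_ler_powR => //; first exact: ltW.
  (* By injectivity the sum runs over the image of [f], which is part of the sum over all entries of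
     [y]. *)
  pose S := imset f (mem predT).
  have -> : \sum_p `|y (f p).1 (f p).2| `^ q = \sum_(z in S) `|y z.1 z.2| `^ q.
    by rewrite big_imset//= => ? ? _ _; exact: f_inj.
  rewrite [leRHS](bigID (mem S))/= lerDl.
  by apply: sumr_ge0 => z _; exact: powR_ge0.
apply: rnormy_le; first exact: rnorm_ge0.
by move=> i j; rewrite (le_trans (xy i j))// le_entry_rnormy.
Qed.

Lemma rnorm_vec_mx (R : realType) (r : \bar R) k l (x : 'rV[R]_(k * l)) :
  (1 <= r)%E -> rnorm r (vec_mx x) <= rnorm r x.
Proof.
move=> r1; apply: (@le_rnorm _ _ _ _ _ _ _ _
  (fun p => (ord0, mxvec_index p.1 p.2))) => //.
- by move=> [i j] [i' j'] /= [e]; exact/enum_rank_inj/val_inj.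
- by move=> i j /=; rewrite mxE.
Qed.

(** Hoelder bounds entry i of [Y *m g] by the r-norm of row i times the dual norm of [g]. Taking the
    r-norm over i recombines the rows into the entrywise norm of [Y]. *)
Lemma rnorm_mulmx (R : realType) (r : \bar R) n k (Y : 'M[R]_(n, k))
    (g : 'cV[R]_k) :
  (1 <= r)%E -> rnorm r (Y *m g) <= rnorm r Y * dual_rnorm r g.
Proof.
move=> r1.
have d0 : 0 <= dual_rnorm r g by exact: rnorm_ge0.
have row_le i : `|(Y *m g) i 0| <= \sum_j `|Y i j| * `|g j 0|.
  rewrite mxE (le_trans (ler_norm_sum _ _ _))//.
  by apply: ler_sum => j _; rewrite normrM.
(* For r = +oo the dual norm is the plain sum of the absolute entries. *)
case: r r1 d0 => [q|_ d0|//]; last first.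
  apply: rnormy_le => [|i j]; first by rewrite mulr_ge0// rnorm_ge0.
  have -> : dual_rnorm +oo%E g = \sum_j `|g j 0|.
    rewrite /dual_rnorm hoelder_conjugatey /= invr1 powRr1.
      by apply: eq_bigr => j' _; rewrite big_ord1 powRr1.
    by apply: sumr_ge0 => ? _; apply: sumr_ge0 => ? _; exact: powR_ge0.
  rewrite ord1 (le_trans (row_le i))// mulr_sumr; apply: ler_sum => j' _.
  by apply: ler_wpM2r => //; exact: le_entry_rnormy.
rewrite lee_fin => q1 d0; have q0 : 0 < q by exact: lt_le_trans q1.
apply: rnorm_fin_le => //; first by rewrite mulr_ge0// rnorm_ge0.
rewrite powRM ?rnorm_ge0// rnorm_finX// mulr_suml; apply: ler_sum => i _.
rewrite big_ord1; set s := \sum_j _.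
have s0 : 0 <= s by apply: sumr_ge0 => j _; exact: powR_ge0.
(* With both factors under one q-th power, what remains is Hoelder for row i. *)
have -> : s * dual_rnorm q%:E g `^ q = (s `^ q^-1 * dual_rnorm q%:E g) `^ q.
  by rewrite powRM ?powR_ge0// -powRrM mulVf ?gt_eqF// powRr1.
apply: ge0_ler_powR; rewrite ?nnegrE ?(ltW q0)//.
  by rewrite mulr_ge0// powR_ge0.
rewrite (le_trans (row_le i))// /s /dual_rnorm.
(* At q = 1 the conjugate exponent is +oo, so the dual norm is a maximum and this case is
   separate. *)
move: q1; rewrite le_eqVlt => /predU1P[<-|q1].
  rewrite hoelder_conjugate1 invr1 powRr1; last by apply: sumr_ge0 => j _; exact: powR_ge0.
  rewrite mulr_suml; apply: ler_sum => j _; rewrite powRr1//.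
  by apply: ler_wpM2l => //; exact: le_entry_rnormy.
have [q' q'0 qq'] : exists2 q', 0 < q' & hoelder_conjugate q%:E = q'%:E /\ q^-1 + q'^-1 = 1.
  exists (q / (q - 1)); first by rewrite divr_gt0// subr_gt0.
  rewrite /hoelder_conjugate/= eqe gt_eqF// inver subr_eq0 gt_eqF//; split => //.
  by rewrite invf_div mulrBl divff ?gt_eqF// mul1r addrC subrK.
rewrite qq'.1 (le_trans (hoelder_sum _ _ _ _ _ _ q0 q'0 qq'.2))//= ler_wpM2l ?powR_ge0//.
by under [in leRHS]eq_bigr do rewrite big_ord1.
Qed.

(** Half of the equivalence with the max norm, with C = (k l)^(1/q) for finite q and C = 1 for r =
    +oo. It links the r-norm to the topology of matrices, which is that of the max norm. *)
Lemma rnorm_le_entries (R : realType) (r : \bar R) k l :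
  (1 <= r)%E -> exists2 C : R, 0 <= C & forall (x : 'M[R]_(k, l)) (e : R),
    0 <= e -> (forall i j, `|x i j| <= e) -> rnorm r x <= C * e.
Proof.
case: r => [q|_|//].
  rewrite lee_fin => q1; have q0 : 0 < q by exact: lt_le_trans q1.
  exists ((k * l)%:R `^ q^-1) => [|x e e0 xe]; first exact: powR_ge0.
  apply: rnorm_fin_le; rewrite ?mulr_ge0 ?powR_ge0//.
  rewrite powRM ?powR_ge0// -powRrM mulVf ?gt_eqF// powRr1//.
  rewrite pair_bigA/= (@le_trans _ _ (\sum_(p : 'I_k * 'I_l) e `^ q))//.
    by apply: ler_sum => -[i j] _; apply: ge0_ler_powR; rewrite ?nnegrE ?(ltW q0)//=.
  by rewrite sumr_const card_prod !card_ord mulr_natl.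
by exists 1 => // x e e0 xe; rewrite mul1r rnormy_le.
Qed.

(** * Borel measurability of Lipschitz functions and of the transport cost *)

Lemma closed_measurable_borel_vec (R : realType) d (A : set 'rV[R]_d) :
  closed A -> measurable (A : set (borel_vec R d)).
Proof.
move=> cA; rewrite -(setCK A); apply: measurableC; apply: sub_sigma_algebra.
exact: closed_openC.
Qed.

Lemma continuous_measurable_borel_vec (R : realType) d (F : 'rV[R]_d -> R) :
  continuous F -> measurable_fun [set: borel_vec R d] (F : borel_vec R d -> R).
Proof.
move=> /continuousP cF; apply: (measurability _ (RGenOpens.measurableE R)).
move=> _ [_ [a [b ->]] <-]; rewrite setTI.
by apply: sub_sigma_algebra; apply: cF; exact: interval_open.
Qed.

Lemma rnorm_lipschitz_continuous (R : realType) (r : \bar R) d (K : R)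
    (F : 'rV[R]_d -> R) :
  (1 <= r)%E -> 0 <= K -> (forall x y, `|F x - F y| <= K * rnorm r (x - y)) ->
  continuous F.
Proof.
move=> r1 K0 FK x; have [C C0 Cr] := @rnorm_le_entries R r 1 d r1.
have FF : Filter (nbhs x) by exact: nbhs_filter.
apply/cvgrPdist_le => e e0.
(* The summand 1 keeps the divisor positive when [K * C] is 0. *)
have KC0 : 0 < K * C + 1 by rewrite ltr_wpDl// mulr_ge0.
near=> y; rewrite (le_trans (FK _ _))//.
have xy : `|x - y| <= e / (K * C + 1).
  near: y; apply: cvgr_dist_le; [exact: cvg_id|exact: divr_gt0].
have e'0 : 0 <= e / (K * C + 1) by rewrite divr_ge0// ltW.
have := Cr (x - y) _ e'0.
have xyij i j : `|(x - y) i j| <= e / (K * C + 1).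
  rewrite (le_trans _ xy)// -[leRHS]/(mx_norm (x - y)) mx_normrE.
  exact: (le_bigmax 0 (fun p => `|(x - y) p.1 p.2|) (i, j)).
move=> /(_ xyij) /(ler_wpM2l K0) /le_trans; apply.
by rewrite mulrA mulrCA ger_pMr// ler_pdivrMr// mul1r lerDl.
Unshelve. all: end_near. Qed.

Lemma measurable_rnorm d (T : measurableType d) (R : realType) (r : \bar R)
    k l (f : T -> 'M[R]_(k, l)) :
  (forall i j, measurable_fun setT (fun t => f t i j)) ->
  measurable_fun setT (fun t => rnorm r (f t)).
Proof.
move=> mf.
have mn i j : measurable_fun setT (fun t => `|f t i j|).
  exact: measurableT_comp (mf i j).
have mmax (I : Type) (s : seq I) (g : I -> T -> R) :
    (forall i, measurable_fun setT (g i)) ->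
    measurable_fun setT (fun t => \big[Num.max/0]_(i <- s) g i t).
  move=> mg; elim: s => [|i s IH].
    by under eq_fun do rewrite big_nil; exact: measurable_cst.
  by under eq_fun do rewrite big_cons; exact: measurable_maxr.
case: r => [q||] /=; [|by do 2 apply: (mmax _ _ _) => ?|by do 2 apply: (mmax _ _ _) => ?].
apply: (measurableT_comp (measurable_powR _)).
apply: measurable_sum => i; apply: measurable_sum => j.
exact: (measurableT_comp (measurable_powR _)).
Qed.

(** The square carries the product of the Borel sigma-algebras, so measurability is obtained from
    the coordinates rather than from continuity on the product. *)
Lemma measurable_rnormB (R : realType) (r : \bar R) d :
  measurable_fun [set: borel_vec R d * borel_vec R d]
    (fun z => rnorm r ((z.1 : 'rV[R]_d) - (z.2 : 'rV[R]_d))).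
Proof.
have mc (i : 'I_1) (j : 'I_d) :
    measurable_fun [set: borel_vec R d] (fun x : borel_vec R d => (x : 'rV[R]_d) i j).
  by apply: continuous_measurable_borel_vec; exact: coord_continuous.
apply: measurable_rnorm => i j.
under eq_fun do rewrite mxE mxE.
apply: measurable_funB.
- by apply: (measurableT_comp (mc i j)); exact: measurable_fst.
- by apply: (measurableT_comp (mc i j)); exact: measurable_snd.
Qed.

(** * Empirical distribution and transport bound *)

Lemma integral_empirical d (X : measurableType d) (R : realType) (N : nat)
    (s : N.-tuple X) (F : X -> R) :
  (forall x, 0 <= F x) -> measurable_fun setT F ->
  (\int[empirical R s]_x (F x)%:E = (N%:R^-1 * \sum_(i < N) F (tnth s i))%:E)%E.
Proof.
move=> F0 mF.
have mEF : measurable_fun setT (EFin \o F) by exact/measurable_EFinP.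
rewrite /empirical ge0_integral_mscale//=; last by move=> x _; rewrite lee_fin.
rewrite ge0_integral_measure_sum//; last by move=> x _; rewrite lee_fin.
rewrite EFinM -sumEFin; congr (_ * _)%E; apply: eq_bigr => i _.
by rewrite integral_dirac// diracT mul1e (tnth_nth point).
Qed.

Lemma empirical_carried d (X : measurableType d) (R : realType) (N : nat)
    (s : N.-tuple X) (A : set X) :
  (0 < N)%N -> (forall i, A (tnth s i)) -> empirical R s A = 1%E.
Proof.
move=> N0 sA.
have -> : (empirical R s A = N%:R^-1%:E * \sum_(k < N) \d_(nth point s k) A)%E by [].
have -> : (\sum_(k < N) \d_(nth point s k) A = \sum_(k < N) (1 : R)%:E)%E.
  by apply: eq_bigr => i _; rewrite diracE mem_set// -tnth_nth.
rewrite sumEFin sumr_const card_ord -EFinM mulVf// pnatr_eq0.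
by rewrite -lt0n.
Qed.

(** The cost is integrated over [D] only, as in [wasserstein]. Since the complement of [D] is null,
    the integral of [f] restricts to [D]; that of [g] can only grow when extended back to the whole
    space. *)
Lemma integral_le_slack d (T : measurableType d) (R : realType)
    (mu : {measure set T -> \bar R}) (D : set T) (f g c : T -> R) (K : R) :
  measurable D -> mu (~` D) = 0%E -> 0 <= K ->
  measurable_fun setT f -> measurable_fun setT g -> measurable_fun setT c ->
  (forall z, 0 <= f z) -> (forall z, 0 <= g z) -> (forall z, 0 <= c z) ->
  (forall z, f z <= g z + K * c z) ->
  (\int[mu]_z (f z)%:E <=
    \int[mu]_z (g z)%:E + K%:E * \int[mu]_(z in D) (c z)%:E)%E.
Proof.
move=> mD muD K0 mf mg mc f0 g0 c0 fgc.
have mE (k : T -> R) : measurable_fun setT k -> measurable_fun D (EFin \o k).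
  by move=> mk; apply/measurable_EFinP; exact: measurable_funTS.
have mKc : measurable_fun setT (fun z => K * c z) by exact: measurable_funM.
rewrite (@ge0_negligible_integral _ _ _ mu setT (~` D))//.
- rewrite setDE setCK setTI.
  apply: (@le_trans _ _ (\int[mu]_(z in D) (g z)%:E +
      K%:E * \int[mu]_(z in D) (c z)%:E)%E); last first.
    rewrite leeD2r// ge0_subset_integral//; first exact/measurable_EFinP.
    by move=> z _; rewrite lee_fin.
  rewrite -ge0_integralZl//; [|exact: mE|by move=> z _; rewrite lee_fin].
  rewrite -ge0_integralD//; [|by move=> z _; rewrite lee_fin|exact: mE|
    by move=> z _; rewrite lee_fin mulr_ge0|exact: (mE _ mKc)].
  apply: ge0_le_integral => //; [by move=> z _; rewrite lee_fin|exact: mE| |].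
    exact: (mE (fun z => g z + K * c z) (measurable_funD mg mKc)).
  by move=> z _; rewrite -EFinM -EFinD lee_fin.
- exact: measurableC.
- exact/measurable_EFinP.
- by move=> z _; rewrite lee_fin.
Qed.

(** The infimum over couplings is approached by a nearly optimal coupling, and its excess cost then
    tends to 0. *)
Lemma expectation_le_wasserstein (R : realType) (r : \bar R) d
    (Xi : set 'rV[R]_d) (P : probability (borel_vec R d) R) N
    (s : N.-tuple (borel_vec R d)) (F : 'rV[R]_d -> R) (K eps : R) :
  (1 <= r)%E -> (0 < N)%N -> closed Xi -> P Xi = 1%E ->
  (forall i, Xi (tnth s i)) ->
  0 <= K -> (forall x, 0 <= F x) ->
  (forall x y, `|F x - F y| <= K * rnorm r (x - y)) ->
  (wasserstein r Xi P (empirical R s) <= eps%:E)%E ->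
  ('E_P[F : borel_vec R d -> R] <=
    (N%:R^-1 * \sum_(i < N) F (tnth s i) + K * eps)%:E)%E.
Proof.
move=> r1 N0 cXi PXi sXi K0 F0 FK W.
have mF := continuous_measurable_borel_vec _ _ _ (rnorm_lipschitz_continuous _ _ _ _ _ r1 K0 FK).
have mXi := closed_measurable_borel_vec _ _ _ cXi.
apply/lee_addgt0Pr => e e0.
(* The excess [e / (K + 1)] costs at most [e] after multiplication by [K], also when [K] is 0. *)
have e'0 : 0 < e / (K + 1) by rewrite divr_gt0// ltr_wpDl.
have : (wasserstein r Xi P (empirical R s) < (eps + e / (K + 1))%:E)%E.
  by rewrite (le_lt_trans W)// lte_fin ltrDl.
move=> /ereal_inf_lt[_ [Pi coupl <-] Pilt].
have mX2 : measurable (Xi `*` Xi : set (borel_vec R d * borel_vec R d)).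
  exact: measurableX.
have m1 : measurable_fun setT (fst : borel_vec R d * borel_vec R d -> _) by exact: measurable_fst.
have m2 : measurable_fun setT (snd : borel_vec R d * borel_vec R d -> _) by exact: measurable_snd.
(* Both marginals give [Xi] full mass, the second because all samples lie in [Xi]; a union bound
   finishes. *)
have PiX : Pi (~` (Xi `*` Xi)) = 0%E.
  apply/eqP; rewrite eq_le measure_ge0 andbT.
  have c1 : Pi (fst @^-1` (~` Xi)) = 0%E.
    rewrite (coupl _ (measurableC mXi)).1.
    by have := probability_setC P mXi; rewrite PXi subee.
  have c2 : Pi (snd @^-1` (~` Xi)) = 0%E.
    have mXi2 : measurable (snd @^-1` Xi : set (borel_vec R d * borel_vec R d)).
      by rewrite -[X in measurable X]setTI; exact: m2.
    have := probability_setC Pi mXi2.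
    by rewrite (coupl _ mXi).2 empirical_carried// subee.
  have mm1 : measurable (fst @^-1` (~` Xi) : set (borel_vec R d * borel_vec R d)).
    by rewrite -[X in measurable X]setTI; apply: m1 => //; exact: measurableC.
  have mm2 : measurable (snd @^-1` (~` Xi) : set (borel_vec R d * borel_vec R d)).
    by rewrite -[X in measurable X]setTI; apply: m2 => //; exact: measurableC.
  have : (Pi (fst @^-1` (~` Xi) `|` snd @^-1` (~` Xi)) <= 0)%E.
    apply: (le_trans (measureU2 Pi mm1 mm2)).
    by move: c1 c2 => /= -> ->; rewrite adde0.
  apply: le_trans.
  apply: le_measure; rewrite ?inE//; [exact: measurableC|exact: measurableU|].
  by move=> z /= /not_andP.
(* Both marginals are pushforwards of [Pi], so both means of [F] become integrals against [Pi] and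
   can be compared pointwise. *)
have marg1 : ('E_P[F : borel_vec R d -> R] = \int[Pi]_z (F z.1)%:E)%E.
  rewrite unlock.
  rewrite (eq_measure_integral (pushforward Pi fst)); last first.
    by move=> A mA _; exact: (esym (coupl _ mA).1).
  rewrite ge0_integral_pushforward//; first exact/measurable_EFinP.
  by move=> y _; rewrite lee_fin.
have marg2 : (\int[empirical R s]_x (F x)%:E = \int[Pi]_z (F z.2)%:E)%E.
  rewrite (eq_measure_integral (pushforward Pi snd)); last first.
    by move=> A mA _; exact: (esym (coupl _ mA).2).
  rewrite ge0_integral_pushforward//; first exact/measurable_EFinP.
  by move=> y _; rewrite lee_fin.
have mrn := measurable_rnormB R r d.
have mF1 : measurable_fun setT (fun z : borel_vec R d * borel_vec R d => F z.1).
  exact: measurableT_comp mF m1.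
have mF2 : measurable_fun setT (fun z : borel_vec R d * borel_vec R d => F z.2).
  exact: measurableT_comp mF m2.
rewrite marg1.
have c0 (z : borel_vec R d * borel_vec R d) :
  0 <= rnorm r ((z.1 : 'rV[R]_d) - (z.2 : 'rV[R]_d)) by exact: rnorm_ge0.
have FK2 (z : borel_vec R d * borel_vec R d) :
    F z.1 <= F z.2 + K * rnorm r ((z.1 : 'rV[R]_d) - (z.2 : 'rV[R]_d)).
  by rewrite -lerBlDl (le_trans (ler_norm _))// FK.
apply: (le_trans (integral_le_slack _ _ _ _ _ _ _ _ _ mX2 PiX K0 mF1 mF2 mrn
  (fun z => F0 z.1) (fun z => F0 z.2) c0 FK2)).
rewrite -marg2 integral_empirical// EFinD -addeA leeD//.
apply: (@le_trans _ _ (K%:E * (eps + e / (K + 1))%:E)%E).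
  by apply: lee_wpmul2l; rewrite ?lee_fin//; exact: ltW.
rewrite -EFinM -EFinD lee_fin mulrDr lerD2l mulrCA ger_pMr//.
by rewrite ler_pdivrMr ?mul1r ?lerDl// ltr_wpDl.
Qed.

(** * Outer and inner probability of possibly non-measurable events *)

(** The outer measure is an infimum over countable measurable covers; the union of a nearly optimal
    cover serves as [B]. *)
Lemma mu_ext_cover d (X : measurableType d) (R : realType)
    (P : probability X R) (E : set X) (b e : R) :
  0 < e -> (mu_ext P E <= b%:E)%E ->
  exists2 B, measurable B /\ E `<=` B & (P B <= (b + e)%:E)%E.
Proof.
move=> e0 Eb.
have : (mu_ext P E < (b + e)%:E)%E by rewrite (le_lt_trans Eb)// lte_fin ltrDl.
move=> /ereal_inf_lt[_ [A [mA EA] <-] Alt].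
exists (\bigcup_k A k); first by split => //; exact: bigcupT_measurable.
by rewrite (le_trans _ (ltW Alt))// measure_sigma_subadditive//; exact: bigcupT_measurable.
Qed.

(** A form of continuity from below for outer measure: a uniform bound on increasing sets passes to
    their union, up to [e]. *)
Lemma mu_ext_bigcup_cover d (X : measurableType d) (R : realType)
    (P : probability X R) (E : (set X)^nat) (b e : R) :
  0 < e -> {homo E : i j / (i <= j)%N >-> i `<=` j} ->
  (forall n, (mu_ext P (E n) <= b%:E)%E) ->
  exists2 B, measurable B /\ \bigcup_n E n `<=` B & (P B <= (b + e)%:E)%E.
Proof.
move=> e0 Emono Eb.
have /choice[B HB] n : exists B, [/\ measurable B, E n `<=` B & (P B <= (b + e)%:E)%E].
  by have [B [mB EB] PB] := @mu_ext_cover _ _ _ P _ _ _ e0 (Eb n); exists B.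
(* The E n may be non-measurable, so B need not increase; C does and still covers E. *)
pose C n := \bigcap_(j in [set j | (n <= j)%N]) B j.
have mC n : measurable (C n).
  by apply: bigcap_measurableType => j _; have [] := HB j.
have mUC : measurable (\bigcup_n C n) by exact: bigcupT_measurable.
exists (\bigcup_n C n).
  split => // s [n _ Es]; exists n => // j /= nj.
  by have [_ EB _] := HB j; apply: EB; exact: Emono Es.
have Cmono : {homo C : n m / (n <= m)%N >-> (n <= m)%O}.
  move=> i j ij; rewrite subsetEset => s Cs k /= jk; apply: Cs => /=.
  exact: leq_trans jk.
have cvgC := nondecreasing_cvg_mu (mu := P) mC mUC Cmono.
rewrite -(cvg_lim _ cvgC)//; apply: lime_le.
  by apply/cvg_ex; eexists; exact: cvgC.
apply: nearW => n /=; have [mB _ PB] := HB n.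
rewrite (le_trans _ PB)//; apply: le_measure; rewrite ?inE//.
by move=> s; apply => /=.
Qed.

(** Enlarging [M] to a measurable null set [M'] makes the complement of [B] and [M'] a measurable
    subset of [E] of probability at least 1 - b - e; then [e] tends to 0. *)
Lemma inner_prob_ge d (X : measurableType d) (R : realType)
    (P : probability X R) (E M : set X) (b : R) :
  P.-negligible M ->
  (forall e, 0 < e -> exists2 B, measurable B /\ ~` (B `|` M) `<=` E &
    (P B <= (b + e)%:E)%E) ->
  ((1 - b)%:E <= inner_prob P E)%E.
Proof.
move=> [M' [mM' PM' MM']] HB; apply/lee_addgt0Pr => e e0.
have [B [mB BE] PB] := HB e e0.
have mBM : measurable (B `|` M') by exact: measurableU.
rewrite -leeBlDr//; apply: (@le_trans _ _ (P (~` (B `|` M')))).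
  rewrite probability_setC// -EFinB -addrA -opprD EFinB leeB//.
  apply: (le_trans (measureU2 P mB mM')).
  by rewrite [X in (_ + X)%E]PM' adde0.
apply: ereal_sup_ubound; exists (~` (B `|` M')) => //; split.
  exact: measurableC.
by apply: subset_trans BE; apply: subsetC; exact: setUS.
Qed.

(** The event is a product set, whose probability is a product of factors equal to 1. *)
Lemma prob_power_carried d (X : measurableType d) (R : realType)
    (P : probability X R) n (A : set X) :
  measurable A -> P A = 1%E ->
  {ae prob_power P n, forall s, forall i, A (tnth s i)}.
Proof.
move=> mA PA.
have mD : measurable [set s : n.-tuple X | forall i, A (tnth s i)].
  rewrite (_ : mkset _ = \bigcap_(i in [set: 'I_n])
      ((fun s : n.-tuple X => tnth s i) @^-1` A)).
    apply: fin_bigcap_measurable => // i _.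
    by rewrite -[X in measurable X]setTI; exact: measurable_tnth.
  by apply/seteqP; split => s /= As i => [_|]; exact: As.
exists (~` [set s : n.-tuple X | forall i, A (tnth s i)]); split => //.
  exact: measurableC.
have := probability_setC (prob_power P n) mD.
have -> := prob_powerE P (A := fun=> A) (fun=> mA).
by rewrite big1// subee.
Qed.

(** * Inversion of the concentration bound *)

(** With x = log(c1/beta)/(c2 N), the bound at [e] is at most [beta] as soon as x is at most the
    power of [e] in the exponent. All radii [e] above the confidence radius are covered, since the
    lemma is applied to slightly larger ones. *)
Lemma conc_bound_le (R : realType) (c1 c2 a beta : R) (kappa N : nat) (e : R) :
  (0 < kappa)%N -> (0 < N)%N -> 1 < a -> 0 < beta -> beta <= c1 -> 0 < c2 ->
  0 < e -> conf_radius c1 c2 a kappa beta N <= e ->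
  conc_bound c1 c2 a kappa N e <= beta.
Proof.
move=> k0 N0 a1 b0 bc1 c20 e0.
have c10 : 0 < c1 by exact: lt_le_trans bc1.
have a0 : 0 < a by exact: lt_trans a1.
have N0' : 0 < N%:R :> R by rewrite ltr0n.
have kR : 0 < kappa%:R :> R by rewrite ltr0n.
have cN : 0 < c2 * N%:R by exact: mulr_gt0.
have l0 : 0 <= ln (c1 * beta^-1) by rewrite ln_ge0// ler_pdivlMr// mul1r.
have x0 : 0 <= ln (c1 * beta^-1) / (c2 * N%:R) by rewrite divr_ge0// ltW.
have bound y : ln (c1 * beta^-1) / (c2 * N%:R) <= y ->
    c1 * expR (- (c2 * N%:R * y)) <= beta.
  rewrite ler_pdivrMr// [y * _]mulrC => ly; rewrite [c1 * _]mulrC -ler_pdivlMr//.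
  rewrite -[leRHS]lnK ?posrE ?divr_gt0// ler_expR.
  rewrite -[beta / c1]invf_div lnV ?posrE ?divr_gt0//.
  by rewrite lerN2.
(* The threshold on [N] says x <= 1, that is, that the radius is at most 1; the case splits of
   [conf_radius] and [conc_bound] thus match. *)
have thr : (ln (c1 * beta^-1) / c2 <= N%:R) = (ln (c1 * beta^-1) / (c2 * N%:R) <= 1).
  by rewrite !ler_pdivrMr// mul1r [c2 * _]mulrC.
rewrite /conf_radius /conc_bound thr.
move: x0 bound {l0 thr}; set x := ln _ / (c2 * _) => x0 bound.
have [x1|x1] := leP x 1; have [e1|e1] := leP e 1 => xe; apply: bound.
- rewrite -powR_mulrn ?(ltW e0)// -(powR_invK _ _ _ kR x0).
  by apply: ge0_ler_powR; rewrite ?nnegrE ?(ltW kR) ?(ltW e0) ?powR_ge0.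
(* Here x <= 1 < e <= e^a, the last step by a > 1. *)
- exact: le_trans x1 (le_trans (ltW e1) (le1r_powR (ltW e1) (ltW a1))).
(* Impossible case: x > 1 makes the radius x^(1/a) exceed 1, hence also [e]. *)
- move: (le_trans xe e1); rewrite leNgt => /negP; case.
  have -> : 1 = 1 `^ a^-1 :> R by rewrite powR1.
  by apply: gt0_ltr_powR; rewrite ?nnegrE ?invr_gt0.
- rewrite -(powR_invK _ _ _ a0 x0).
  by apply: ge0_ler_powR; rewrite ?nnegrE ?(ltW a0) ?(ltW e0) ?powR_ge0.
Qed.

(** * Norms of blocks of the data matrix *)

(* The Lipschitz hypothesis on (f2, f3) stacks the future outputs first, the data
   matrix stacks them last. *)
Lemma rnorm_swap_col (R : realType) (r : \bar R) m1 m2 n (A : 'M[R]_(m1 + m2, n)) :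
  (1 <= r)%E -> rnorm r (col_mx (dsubmx A) (usubmx A)) <= rnorm r A.
Proof.
move=> r1.
pose sw m1 m2 (i : 'I_(m2 + m1)) : 'I_(m1 + m2) :=
  match fintype.split i with inl k => rshift m1 k | inr k => lshift m2 k end.
have swK : cancel (sw m1 m2) (sw m2 m1).
  move=> i; rewrite /sw; case: (split_ordP i) => k ->.
    by rewrite (unsplitK (inr k)).
  by rewrite (unsplitK (inl k)).
apply: (@le_rnorm _ _ _ _ _ _ _ _ (fun p => (sw m1 m2 p.1, p.2))) => //.
  by move=> [i j] [i' j'] [/(can_inj swK) -> ->].
by move=> i j /=; rewrite mxE /sw; case: (fintype.split i) => k; rewrite mxE.
Qed.

Lemma rnorm_dsubmx (R : realType) (r : \bar R) m1 m2 n (A : 'M[R]_(m1 + m2, n)) :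
  (1 <= r)%E -> rnorm r (dsubmx A) <= rnorm r A.
Proof.
move=> r1; apply: (@le_rnorm _ _ _ _ _ _ _ _ (fun p => (rshift m1 p.1, p.2))) => //.
  by move=> [i j] [i' j'] [/addnI/val_inj -> ->].
by move=> i j /=; rewrite mxE.
Qed.

(** The source of the factor [dual_rnorm r g] in both Lipschitz constants. *)
Lemma rnorm_vec_mxM (R : realType) (r : \bar R) n k (x : 'rV[R]_(n * k))
    (g : 'cV[R]_k) :
  (1 <= r)%E -> rnorm r (vec_mx x *m g) <= dual_rnorm r g * rnorm r x.
Proof.
move=> r1; rewrite (le_trans (rnorm_mulmx _ _ _ _ _ _ r1))// mulrC.
by rewrite ler_wpM2l ?rnorm_ge0 ?rnorm_vec_mx.
Qed.

(** * The event of a large transport distance *)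

(** Outside [B] the distance is at most the confidence radius, which is what the transport bound
    asks for. *)
Lemma wasserstein_gt_cover (R : realType) (r : \bar R) d (Xi : set 'rV[R]_d)
    (P : probability (borel_vec R d) R) (c1 c2 a beta : R) (kappa N : nat) :
  (0 < kappa)%N -> (0 < N)%N -> 1 < a -> 0 < beta -> beta <= c1 -> 0 < c2 ->
  (forall (n : nat) (eps : R), (0 < n)%N -> 0 < eps ->
     (mu_ext (prob_power P n)
        [set s | eps%:E <= wasserstein r Xi P (empirical R s)]
      <= (conc_bound c1 c2 a kappa n eps)%:E)%E) ->
  forall e, 0 < e -> exists2 B, measurable B /\
    [set s | (conf_radius c1 c2 a kappa beta N)%:E
               < wasserstein r Xi P (empirical R s)]%E `<=` B &
    (prob_power P N B <= (beta + e)%:E)%E.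
Proof.
move=> k0 N0 a1 b0 bc1 c20 conc e e0.
set eps := conf_radius _ _ _ _ _ _.
(* If beta = c1 then eps = 0, where the concentration inequality says nothing; hence
   the approximation of the event by radii eps + 1/(n+1). *)
have eps0 : 0 <= eps by rewrite /eps /conf_radius; case: ifP => _; exact: powR_ge0.
pose E n := [set s : N.-tuple (borel_vec R d) |
  ((eps + n.+1%:R^-1)%:E <= wasserstein r Xi P (empirical R s))%E].
have en0 n : 0 < eps + n.+1%:R^-1 by rewrite ltr_wpDl.
have [B [mB EB] PB] : exists2 B, measurable B /\ \bigcup_n E n `<=` B &
    (prob_power P N B <= (beta + e)%:E)%E.
  apply: mu_ext_bigcup_cover => //.
    move=> i j ij s; rewrite /E /=; apply: le_trans.
    by rewrite lee_fin lerD2l lef_pV2 ?posrE// ler_nat.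
  move=> n; apply: (le_trans (conc N _ N0 (en0 n))).
  by rewrite lee_fin conc_bound_le// lerDl.
exists B => //; split => // s /= Ws; apply: EB.
suff [n nW] : exists n : nat,
    ((eps + n.+1%:R^-1)%:E <= wasserstein r Xi P (empirical R s))%E by exists n.
(* An infinite distance exceeds every radius; for a finite one, some 1/(n+1) fits into its gap above
   [eps]. *)
move: Ws; case: (wasserstein _ _ _ _) => [w| |//]; last first.
  by move=> _; exists 0%N; exact: leey.
rewrite lte_fin -subr_gt0 => wpos.
have [n _ nw] := near_infty_natSinv_lt (PosNum wpos).
exists n; rewrite lee_fin -lerBrDl ltW//.
exact: (nw n (leqnn n)).
Qed.

(** * Lipschitz constants of the cost and of the excess in xi *)

(** The constant [c] stands for the input cost and cancels in the difference, as does the shift [y].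
    What is left is the data matrix with its two blocks exchanged, applied to [g]. *)
Lemma rlipschitz_output (R : realType) (r : \bar R) (p Tini Tf T : nat)
    (f2 : 'cV[R]_(Tf * p) -> R) (f3 : 'cV[R]_(Tini * p) -> R) (L c : R)
    (y : 'cV[R]_(Tini * p)) (g : 'cV[R]_(page_cols T Tini Tf))
    (xi xi' : 'rV[R]_(xi_dim p Tini Tf T)) :
  (1 <= r)%E -> 0 <= L ->
  rlipschitz r L (fun z : 'cV[R]_(Tf * p + Tini * p) =>
    f2 (usubmx z) + f3 (dsubmx z)) ->
  `|(c + f2 (Yf xi *m g) + f3 (Yp xi *m g - y))
    - (c + f2 (Yf xi' *m g) + f3 (Yp xi' *m g - y))|
  <= L * dual_rnorm r g * rnorm r (xi - xi').
Proof.
move=> r1 L0 lip.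
have := lip (col_mx (Yf xi *m g) (Yp xi *m g - y))
  (col_mx (Yf xi' *m g) (Yp xi' *m g - y)).
have cancel_c (v w v' w' : R) : c + v + w - (c + v' + w') = v + w - (v' + w').
  by lra.
rewrite !col_mxKu !col_mxKd cancel_c => /le_trans; apply.
rewrite -mulrA ler_wpM2l// (le_trans _ (rnorm_vec_mxM _ _ _ _ _ _ r1))//.
rewrite (le_trans _ (rnorm_swap_col _ _ _ _ _ _ r1))//.
rewrite opp_col_mx add_col_mx opprB addrA subrK -!mulmxBl.
by rewrite -mul_dsub_mx -mul_usub_mx linearB/= linearB/= linearB.
Qed.

(** The positive part is 1-Lipschitz, being (z + |z|)/2, so the constant of [h] is preserved. *)
Lemma rlipschitz_excess (R : realType) (r : \bar R) (p Tini Tf T : nat)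
    (h : 'cV[R]_(Tf * p) -> R) (L t : R)
    (g : 'cV[R]_(page_cols T Tini Tf))
    (xi xi' : 'rV[R]_(xi_dim p Tini Tf T)) :
  (1 <= r)%E -> 0 <= L -> rlipschitz r L h ->
  `|Num.max (h (Yf xi *m g) - t) 0 - Num.max (h (Yf xi' *m g) - t) 0|
  <= L * dual_rnorm r g * rnorm r (xi - xi').
Proof.
move=> r1 L0 lip.
have max_lip (x y : R) : `|Num.max x 0 - Num.max y 0| <= `|x - y|.
  have maxE (z : R) : Num.max z 0 = (z + `|z|) / 2.
    by have [z0|z0] := leP z 0; [rewrite ler0_norm|rewrite gtr0_norm]; lra.
  rewrite !maxE -mulrBl normrM [`|2^-1|]gtr0_norm ?invr_gt0//.
  rewrite ler_pdivrMr// opprD addrACA (le_trans (ler_normD _ _))//.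
  by rewrite mulr_natr mulr2n lerD2l ler_dist_dist.
apply: (le_trans (max_lip _ _)); rewrite opprB addrA subrK.
apply: (le_trans (lip _ _)).
rewrite -mulrA ler_wpM2l// (le_trans _ (rnorm_vec_mxM _ _ _ _ _ _ r1))//.
rewrite (le_trans _ (rnorm_dsubmx _ _ _ _ _ _ r1))//.
by rewrite -mulmxBl -mul_dsub_mx linearB/= linearB.
Qed.

(** * The two out-of-sample guarantees *)

Theorem mainTheorem3
  (R : realType) (m p Tini Tf T N : nat)
  (m_gt0 : (0 < m)%N) (p_gt0 : (0 < p)%N)
  (Tini_gt0 : (0 < Tini)%N) (Tf_gt0 : (0 < Tf)%N)
  (T_gt0 : (0 < T)%N) (N_gt0 : (0 < N)%N)
  (kappa_ge1 : (1 <= page_cols T Tini Tf)%N)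
  (u : 'I_T -> 'cV[R]_m)
  (uini : 'cV[R]_(Tini * m)) (yini : 'cV[R]_(Tini * p))
  (U : set 'cV[R]_(Tf * m))
  (r : \bar R) (r_ge1 : (1 <= r)%E)
  (P : probability (borel_vec R (xi_dim p Tini Tf T)) R)
  (Xi : set 'rV[R]_(xi_dim p Tini Tf T))
  (Xi_support : is_support P Xi)
  (f1 : 'cV[R]_(Tf * m) -> R) (f2 : 'cV[R]_(Tf * p) -> R)
  (f3 : 'cV[R]_(Tini * p) -> R) (h : 'cV[R]_(Tf * p) -> R)
  (f1_ge0 : forall x, 0 <= f1 x) (f2_ge0 : forall x, 0 <= f2 x)
  (f3_ge0 : forall x, 0 <= f3 x)
  (f1_convex : convex_fun f1) (f2_convex : convex_fun f2)
  (f3_convex : convex_fun f3) (h_convex : convex_fun h)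
  (Lobj Lcon : R) (Lobj_gt0 : 0 < Lobj) (Lcon_gt0 : 0 < Lcon)
  (f23_lipschitz : rlipschitz r Lobj
     (fun z : 'cV[R]_(Tf * p + Tini * p) => f2 (usubmx z) + f3 (dsubmx z)))
  (h_lipschitz : rlipschitz r Lcon h)
  (alpha : R) (alpha_in : 0 < alpha < 1)
  (a : R) (a_gt1 : 1 < a)
  (light_tail :
     ('E_P[fun xi => expR (rnorm r (xi : 'rV[R]_(xi_dim p Tini Tf T)) `^ a)%R] < +oo)%E)
  (beta : R) (beta_in : 0 < beta < 1)
  (c1 c2 : R) (c1_gt0 : 0 < c1) (c2_gt0 : 0 < c2) (beta_le_c1 : beta <= c1)
  (concentration : forall (n : nat) (eps : R), (0 < n)%N -> 0 < eps ->
     (mu_ext (prob_power P n)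
        [set s | eps%:E <= wasserstein r Xi P (empirical R s)]
      <= (conc_bound c1 c2 a (page_cols T Tini Tf) n eps)%:E)%E)
  (ghat : N.-tuple (borel_vec R (xi_dim p Tini Tf T)) ->
          'cV[R]_(page_cols T Tini Tf))
  (ghat_opt : {ae prob_power P N, forall s,
     optimizer u f1 f2 f3 h uini yini U r Lobj Lcon alpha
       (conf_radius c1 c2 a (page_cols T Tini Tf) beta N) s (ghat s)}) :
  ((1 - beta)%:E <= inner_prob (prob_power P N)
     [set s | (Jtrue u f1 f2 f3 yini P (ghat s)
               <= (Jhat u f1 f2 f3 yini r Lobj
                     (conf_radius c1 c2 a (page_cols T Tini Tf) beta N)
                     s (ghat s))%:E)%E])%E
  /\
  ((1 - beta)%:E <= inner_prob (prob_power P N)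
     [set s | (cvar P alpha (fun xi => h (Yf xi *m ghat s)) <= 0)%E])%E.
Proof.
have [cXi PXi _] := Xi_support.
have /andP[alpha0 _] := alpha_in; have /andP[beta0 _] := beta_in.
set eps := conf_radius _ _ _ _ _ _ in ghat_opt *.
(* The exceptional samples: those where [ghat] fails to be optimal and those with an entry outside
   the support. *)
have null : (prob_power P N).-negligible
    (~` [set s | optimizer u f1 f2 f3 h uini yini U r Lobj Lcon alpha eps s (ghat s)]
     `|` ~` [set s | forall i, Xi (tnth s i)]).
  apply: negligibleU; first exact: ghat_opt.
  exact: prob_power_carried (closed_measurable_borel_vec _ _ _ cXi) PXi.
have cover := wasserstein_gt_cover _ _ _ _ _ _ _ _ _ _ _
  kappa_ge1 N_gt0 a_gt1 beta0 beta_le_c1 c2_gt0 concentration.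
split; apply: inner_prob_ge null _ => e e0;
  have [B [mB WB] PB] := cover e e0; exists B => //; split => // s.
(* From here on one sample [s] outside [B] and the exceptional set is fixed, with the constraints
   satisfied by [ghat s]. *)
all: rewrite !setCU !setCK => -[Bs [[tau [sl [[_ _ slack sl_ge] _]]] sXi]] /=.
all: have W : (wasserstein r Xi P (empirical R s) <= eps%:E)%E by
  rewrite leNgt; apply/negP => Ws; apply: Bs; exact: WB.
all: set g := ghat s in slack sl_ge *.
all: have d0 : 0 <= dual_rnorm r g by exact: rnorm_ge0.
- have F0 xi : 0 <= f1 (Uf Tini Tf u *m g) + f2 (Yf xi *m g) + f3 (Yp xi *m g - yini).
    by rewrite !addr_ge0.
  have K0 : 0 <= Lobj * dual_rnorm r g by rewrite mulr_ge0// ltW.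
  apply: (le_trans (expectation_le_wasserstein _ _ _ _ _ _ _ _ _ _ r_ge1 N_gt0 cXi
    PXi sXi K0 F0 (fun x y => rlipschitz_output _ _ _ _ _ _ _ _ _ _ _ _ x y r_ge1
      (ltW Lobj_gt0) f23_lipschitz) W)).
  rewrite lee_fin /Jhat mulrAC lerD2r.
  (* The input cost is the same for every sample, so its average over the samples is itself. *)
  under eq_bigr do rewrite -addrA.
  rewrite big_split/= sumr_const card_ord mulrDr -[f1 _ *+ N]mulr_natl mulrA.
  by rewrite mulVf ?mul1r// pnatr_eq0 -lt0n.
- have F0 xi : 0 <= Num.max (h (Yf xi *m g) - - tau) 0 by rewrite le_max lexx orbT.
  have K0 : 0 <= Lcon * dual_rnorm r g by rewrite mulr_ge0// ltW.
  have bound := expectation_le_wasserstein _ _ _ _ _ _ _ _ _ _ r_ge1 N_gt0 cXi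
    PXi sXi K0 F0 (fun x y => rlipschitz_excess _ _ _ _ _ _ _ _ _ _ x y r_ge1
      (ltW Lcon_gt0) h_lipschitz) W.
  (* Each [sl i] dominates the excess of sample i above - tau, so the risk constraint bounds the
     average excess plus the transport penalty by [tau * alpha]. *)
  have le_slack : N%:R^-1 * \sum_(i < N) Num.max (h (Yf (tnth s i) *m g) - - tau) 0
      + Lcon * dual_rnorm r g * eps <= tau * alpha.
    have : N%:R^-1 * \sum_(i < N) Num.max (h (Yf (tnth s i) *m g) - - tau) 0
        <= N%:R^-1 * \sum_(i < N) sl i.
      rewrite ler_wpM2l ?invr_ge0 ?ler0n//; apply: ler_sum => i _.
      by have [hs s0] := sl_ge i; rewrite ge_max s0 opprK addrC hs.
    by move: slack; lra.
  (* The infimum defining the CVaR is tested at - tau: the paper's constraint has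
     the opposite sign for tau. *)
  apply: (@le_trans _ _ ((- tau)%:E + alpha^-1%:E *
      'E_P[fun xi => (Num.max (h (Yf xi *m g) - - tau) 0)%R])%E).
    by apply: ereal_inf_lbound; exists (- tau).
  apply: (@le_trans _ _ ((- tau)%:E + alpha^-1%:E * (tau * alpha)%:E)%E).
    apply: leeD2l; apply: lee_wpmul2l; first by rewrite lee_fin invr_ge0 ltW.
    by apply: (le_trans bound); rewrite lee_fin.
  by rewrite -EFinM -EFinD lee_fin mulrC mulfK ?gt_eqF// addNr.
Qed.
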